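(* Let $\lambda$ be a nonzero real parameter, $m\in\mathbb{N}$ and $r\in\mathbb{N}\cup\{0\}$. For integers $1\le k\le n$, \[ W_{m,r}(n+1,k\mid\lambda)=(r+mk)W_{m,r}(n,k\mid\lambda)+W_{m,r}(n,k-1\mid\lambda)-n\lambda\, W_{m,r}(n,k\mid\lambda). \]
   Context: The degenerate Whitney numbers $W_{m,r}(n,k\mid\lambda)$ ($n,k\ge0$) are defined by \[ \frac{1}{m^k k!}(1+\lambda t)^{r/\lambda}\big((1+\lambda t)^{m/\lambda}-1\big)^k=\sum_{n=k}^\infty W_{m,r}(n,k\mid\lambda)\frac{t^n}{n!}. \] *)

(* Defs.v *)
(* Stdlib reals with Coquelicot *)
From Stdlib Require Import Reals Factorial.
From Coquelicot Require Import Coquelicot.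
Open Scope R_scope.

(* [Rpower x y] is [x^y] only for [0 < x]; here it is used near [t = 0],
   where [0 < 1 + lam * t]. *)
Definition whitney_gf (m r : nat) (lam : R) (k : nat) (t : R) : R :=
  1 / (INR m ^ k * INR (fact k))
  * Rpower (1 + lam * t) (INR r / lam)
  * (Rpower (1 + lam * t) (INR m / lam) - 1) ^ k.

(* [W n k] stands for W_{m,r}(n,k|lam).  The generating function identity
   holds for all [t] in some neighbourhood of 0, which may depend on [k]; the
   sum over n >= k is indexed by [j = n - k].  For [lam <> 0] and [0 < m] this
   determines [W n k] for [k <= n] and leaves it free for [n < k], values that
   do not occur in the expansion. *)
Definition is_degenerate_whitney (m r : nat) (lam : R) (W : nat -> nat -> R)
    : Prop :=
  forall k : nat,
    locally 0 (fun t : R =>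
      is_series (fun j : nat => W (k + j)%nat k
                                * (t ^ (k + j) / INR (fact (k + j))))
                (whitney_gf m r lam k t)).

(* Main.v *)
(** The generating function [f_k] of the [k]-th column satisfies
    [(1 + lam t) f_k' = (r + m k) f_k + f_(k-1)] near [t = 0].  Since the
    coefficients of a convergent power series are determined by its sum, this
    differential equation can be read off coefficient by coefficient. *)
Require Import Defs.
From Stdlib Require Import Reals Lra Lia Arith.
From Coquelicot Require Import Coquelicot.
Open Scope R_scope.

(** Convergence at a single nonzero point suffices: if the radius were at most 0, the terms at
    [e / 2] could not tend to 0. *)
Lemma CV_radius_pos_of_locally (a : nat -> R) (f : R -> R) :
  locally 0 (fun t => is_pseries a t (f t)) -> Rbar_lt 0 (CV_radius a).
Proof.
  intros [e He].
  pose proof (cond_pos e) as Hpos.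
  assert (Hser : is_pseries a (e / 2) (f (e / 2))).
  { apply He. change (Rabs (e / 2 - 0) < e).
    rewrite Rminus_0_r, Rabs_pos_eq; lra. }
  apply Rbar_not_le_lt; intro Hle.
  apply (CV_disk_outside a (e / 2)).
  - apply Rbar_le_lt_trans with (1 := Hle).
    simpl. rewrite Rabs_pos_eq; lra.
  - apply ex_series_lim_0. exists (f (e / 2)). now apply is_pseries_R.
Qed.

Lemma is_pseries_locally_coef_unique (a b : nat -> R) (f : R -> R) (n : nat) :
  locally 0 (fun t => is_pseries a t (f t)) ->
  locally 0 (fun t => is_pseries b t (f t)) -> a n = b n.
Proof.
  intros Ha Hb.
  apply PSeries_ext_recip.
  - exact (CV_radius_pos_of_locally a f Ha).
  - exact (CV_radius_pos_of_locally b f Hb).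
  - generalize (filter_and _ _ Ha Hb); apply filter_imp.
    intros t [Hat Hbt].
    now rewrite (is_pseries_unique _ _ _ Hat), (is_pseries_unique _ _ _ Hbt).
Qed.

Lemma locally_Rabs_lt_Rbar (rho : Rbar) :
  Rbar_lt 0 rho -> locally 0 (fun t : R => Rbar_lt (Rabs t) rho).
Proof.
  intros Hrho. destruct rho as [rho | | ]; simpl in Hrho.
  - exists (mkposreal rho Hrho). intros t Ht.
    change (Rabs (t - 0) < rho) in Ht. now rewrite Rminus_0_r in Ht.
  - apply filter_forall. now intros t.
  - contradiction.
Qed.

(** Inside the disk of convergence [PSeries a] may be differentiated termwise, and [f] coincides
    with it near 0. *)
Lemma is_pseries_locally_derive (a : nat -> R) (f df : R -> R) :
  locally 0 (fun t => is_pseries a t (f t)) ->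
  locally 0 (fun t => is_derive f t (df t)) ->
  locally 0 (fun t => is_pseries (PS_derive a) t (df t)).
Proof.
  intros Ha Hdf.
  generalize (locally_Rabs_lt_Rbar _ (CV_radius_pos_of_locally a f Ha)).
  (* Equal derivatives at [t] require [f] and [PSeries a] to agree on a whole neighbourhood of [t],
     not only at [t]. *)
  generalize (filter_and _ _ (locally_locally _ _ Ha) Hdf).
  intros H1 H2. generalize (filter_and _ _ H1 H2); apply filter_imp.
  intros t [[Hat Hft] Ht].
  replace (df t) with (PSeries (PS_derive a) t).
  - now apply PSeries_correct, ex_pseries_derive.
  - rewrite <- (is_derive_unique _ _ _ Hft). symmetry.
    apply is_derive_unique.
    apply is_derive_ext_loc with (PSeries a).
    + revert Hat; apply filter_imp.
      intros s Hs. now apply is_pseries_unique.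
    + now apply is_derive_PSeries.
Qed.

Lemma locally_0_affine_pos (lam : R) : locally 0 (fun t => 0 < 1 + lam * t).
Proof.
  assert (Hcont : continuous (fun t => 1 + lam * t) 0).
  { apply (ex_derive_continuous (fun t => 1 + lam * t)). now auto_derive. }
  apply Hcont, (open_gt 0). lra.
Qed.

(** With [Q] the power of exponent [m / lam], the derivative of [(Q - 1) ^ S k] is [S k * m * Q * (Q
    - 1) ^ k / (1 + lam * t)]. Writing [Q = (Q - 1) + 1] gives a multiple of the same column plus
    the previous column, whose normalisation appears because [m * S k] cancels against the
    prefactor. *)
Lemma is_derive_whitney_gf (m r k : nat) (lam t : R) :
  (1 <= m)%nat -> lam <> 0 -> 0 < 1 + lam * t ->
  is_derive (whitney_gf m r lam (S k)) t
    (((INR r + INR m * INR (S k)) * whitney_gf m r lam (S k) t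
      + whitney_gf m r lam k t) / (1 + lam * t)).
Proof.
  intros Hm Hlam Ht.
  assert (Hm0 : INR m <> 0) by (apply not_0_INR; lia).
  assert (Hk0 : INR (S k) <> 0) by (apply not_0_INR; lia).
  assert (Hf0 : INR (fact k) <> 0) by apply INR_fact_neq_0.
  assert (Hmk0 : INR m ^ k <> 0) by now apply pow_nonzero.
  unfold whitney_gf, Rpower.
  replace (INR (fact (S k))) with (INR (S k) * INR (fact k))
    by now rewrite <- mult_INR.
  auto_derive; [easy | ].
  change (Init.Nat.pred (S k)) with k.
  replace (match k with 0%nat => 1 | S _ => INR k + 1 end) with (INR (S k))
    by reflexivity.
  cbn [pow].
  set (P := exp (INR r / lam * ln (1 + lam * t))).
  set (Q := exp (INR m / lam * ln (1 + lam * t))).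
  fold (Rminus Q 1).
  set (D := (Q - 1) ^ k).
  field.
  repeat split; try assumption; lra.
Qed.

(** Zero padding below [k] is essential: [W i k] is arbitrary there, while the expansion of the
    generating function starts at [t ^ k]. *)
Definition whitney_coef (W : nat -> nat -> R) (k i : nat) : R :=
  if (i <? k)%nat then 0 else W i k / INR (fact i).

Lemma whitney_coef_ge (W : nat -> nat -> R) (k i : nat) :
  (k <= i)%nat -> whitney_coef W k i = W i k / INR (fact i).
Proof.
  intros Hki. unfold whitney_coef.
  now replace (i <? k)%nat with false by (symmetry; apply Nat.ltb_ge, Hki).
Qed.

Lemma is_pseries_whitney_coef (m r : nat) (lam : R) (W : nat -> nat -> R)
    (k : nat) :
  is_degenerate_whitney m r lam W ->
  locally 0 (fun t => is_pseries (whitney_coef W k) t (whitney_gf m r lam k t)).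
Proof.
  intros HW. generalize (HW k); apply filter_imp. intros t Ht.
  apply is_pseries_R.
  assert (Htail : is_series (fun j => whitney_coef W k (k + j) * t ^ (k + j))
                    (whitney_gf m r lam k t)).
  { revert Ht; apply is_series_ext. intros j.
    rewrite whitney_coef_ge by lia.
    change (W (k + j)%nat k * (t ^ (k + j) / INR (fact (k + j)))
            = W (k + j)%nat k / INR (fact (k + j)) * t ^ (k + j)).
    unfold Rdiv. ring. }
  (* For [k = 0] the tail is the whole series; otherwise the head, over indices 0 to [k], consists
     of padded zeros. *)
  destruct k as [ | k]; [exact Htail | ].
  apply is_series_decr_n with (S k); [lia | ].
  assert (Hhead : sum_n (fun i => whitney_coef W (S k) i * t ^ i) k = 0).
  { rewrite (sum_n_ext_loc _ (fun _ => 0)).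
    - rewrite sum_n_const. apply Rmult_0_r.
    - intros i Hi. unfold whitney_coef.
      replace (i <? S k)%nat with true by (symmetry; apply Nat.ltb_lt; lia).
      apply Rmult_0_l. }
  replace (plus _ _) with (whitney_gf m r lam (S k) t); [exact Htail | ].
  change (whitney_gf m r lam (S k) t
          = whitney_gf m r lam (S k) t
            + - sum_n (fun i => whitney_coef W (S k) i * t ^ i) k).
  rewrite Hhead. ring.
Qed.

Theorem theorem8 (lam : R) (m r : nat) (W : nat -> nat -> R)
    (hlam : lam <> 0) (hm : (1 <= m)%nat)
    (hW : is_degenerate_whitney m r lam W)
    (n k : nat) (hk : (1 <= k)%nat) (hkn : (k <= n)%nat) :
  W (n + 1)%nat k =
    (INR r + INR m * INR k) * W n k + W n (k - 1)%nat
    - INR n * lam * W n k.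
Proof.
  destruct k as [ | k]; [lia | ].
  destruct n as [ | n]; [lia | ].
  replace (S n + 1)%nat with (S (S n)) by lia.
  replace (S k - 1)%nat with k by lia.
  pose proof (is_pseries_whitney_coef m r lam W (S k) hW) as Ha.
  pose proof (is_pseries_whitney_coef m r lam W k hW) as Hb.
  set (a := whitney_coef W (S k)) in *.
  set (b := whitney_coef W k) in *.
  set (c := INR r + INR m * INR (S k)).
  set (f := whitney_gf m r lam) in *.
  assert (Hda : locally 0 (fun t => is_pseries (PS_derive a) t
                  ((c * f (S k) t + f k t) / (1 + lam * t)))).
  { apply is_pseries_locally_derive with (1 := Ha).
    generalize (locally_0_affine_pos lam); apply filter_imp.
    intros t Ht. now apply is_derive_whitney_gf. }
  (* Both sides expand [(1 + lam * t)] times the derivative of [f (S k)]. They are compared at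
     [S n], which is the original [n]; the shift [PS_incr_1] there yields the term in [n * lam]. *)
  assert (Hcoef : PS_plus (PS_derive a)
                    (PS_scal lam (PS_incr_1 (PS_derive a))) (S n)
                  = PS_plus (PS_scal c a) b (S n)).
  { apply is_pseries_locally_coef_unique
      with (f := fun t => c * f (S k) t + f k t).
    - generalize (filter_and _ _ Hda (locally_0_affine_pos lam)).
      apply filter_imp. intros t [Hdt Ht].
      set (d := (c * f (S k) t + f k t) / (1 + lam * t)) in Hdt.
      pose proof (is_pseries_incr_1 _ _ _ Hdt) as H1.
      pose proof (is_pseries_scal lam _ _ _ (Rmult_comm t lam) H1) as H2.
      replace (c * f (S k) t + f k t) with (d + lam * (t * d))
        by (unfold d; field; lra).
      exact (is_pseries_plus _ _ _ _ _ Hdt H2).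
    - generalize (filter_and _ _ Ha Hb); apply filter_imp.
      intros t [Hat Hbt].
      pose proof (is_pseries_scal c _ _ _ (Rmult_comm t c) Hat) as H1.
      exact (is_pseries_plus _ _ _ _ _ H1 Hbt). }
  change (INR (S (S n)) * a (S (S n)) + lam * (INR (S n) * a (S n))
          = c * a (S n) + b (S n)) in Hcoef.
  unfold a, b in Hcoef.
  (* Since [S k <= S n], no padded zero enters the comparison. *)
  rewrite !whitney_coef_ge in Hcoef by lia.
  replace (INR (fact (S (S n)))) with (INR (S (S n)) * INR (fact (S n)))
    in Hcoef by now rewrite <- mult_INR.
  assert (Hf0 : INR (fact (S n)) <> 0) by apply INR_fact_neq_0.
  assert (Hn0 : INR (S (S n)) <> 0) by (apply not_0_INR; lia).
  (* The leading factor [S (S n)] reduces [(S (S n))!] to [(S n)!], so this one factorial clears all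
     denominators. *)
  apply (f_equal (Rmult (INR (fact (S n))))) in Hcoef.
  field_simplify in Hcoef; [ | easy | easy].
  lra.
Qed.
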